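(* Let $d\ge2$ be an integer, let $q>0$, and let $$h_1(t)=\frac1d\sum_{i=0}^{d-1}\left|\sin\left(\pi\frac{t+i}{d}\right)\right|^q,\quad 0\le t\le1.$$ (a) If $q\in\{2,4,6,\dots,2(d-1)\}$, then $h_1(t)=\frac{1}{2^q}\binom{q}{q/2}$ for all $t$. (b) Define the intervals $Q_k=(2(k-1),2k)$ for $k=1,\dots,d-1$, and $Q_d=(2(d-1),\infty)$. Then for $k\in\{1,\dots,d\}$ and $q\in Q_k$ we have $$(-1)^{k-1}h_1'(t)>0,\quad 0<t<1/2.$$ *)

(* Defs.v *)
From HB Require Import structures.
From mathcomp Require Import all_boot all_order all_algebra.
From mathcomp Require Import all_classical all_reals all_analysis.
Set Implicit Arguments.
Unset Strict Implicit.
Unset Printing Implicit Defensive.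
Import Order.TTheory GRing.Theory Num.Theory.
Import numFieldNormedType.Exports.
Local Open Scope ring_scope.

(* Defined for all real t, so that the derivative at interior points of [0, 1]
   is the usual one; note that 0 `^ q = 0 for q > 0. *)
Definition h1 (R : realType) (d : nat) (q t : R) : R :=
  d%:R^-1 * \sum_(i < d) `|sin (pi * ((t + i%:R) / d%:R))| `^ q.

Definition Q (R : realType) (d k : nat) : interval R :=
  if (k < d)%N then `](2 * (k%:R - 1)), (2 * k%:R)[
  else `](2 * (d%:R - 1)), +oo[.

(* Main.v *)
Require Import Defs.
From HB Require Import structures.
From mathcomp Require Import all_boot all_order all_algebra.
From mathcomp Require Import all_classical all_reals all_analysis.
From mathcomp Require Import zify ring lra.
Import Order.TTheory GRing.Theory Num.Theory.
Import numFieldNormedType.Exports.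
Local Open Scope ring_scope.

(* With [theta_i = pi (t + i) / d], [x_i = sin^2 theta_i] and
   [w_i = sin theta_i cos theta_i], one has
   [h1'(t) = (pi q / d^2) * M (q/2 - 1)], where [M r = sum_i w_i x_i^r].
   Expanding [sin^(2m)] into cosines of multiples of [2 theta_i] and summing
   over [i] shows that [h1] is constant for [q = 2m], [m < d], and equals an
   affine function of [(-1)^d cos (2 pi t)] for [q = 2d].  Differentiating,
   [M] vanishes at [0, ..., d-2] and [M (d-1)] has the sign of [(-1)^(d-1)].
   Hence [M r] is [M (d-1)] times the divided difference of [x^r] at the [d]
   distinct nodes [x_i], which by the mean value theorem for divided
   differences has the sign of [r (r-1) ... (r-d+2)]. *)

(** * Alternating binomial sums and arithmetic progressions of cosines *)

Lemma sum_sign_binS (R : pzRingType) (n : nat) (f : nat -> R) :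
  \sum_(k < n.+2) (-1) ^+ k * 'C(n.+1, k)%:R * f k =
  \sum_(k < n.+1) (-1) ^+ k * 'C(n, k)%:R * (f k - f k.+1).
Proof.
under [RHS]eq_bigr do rewrite mulrBr.
rewrite sumrB big_ord_recl [in RHS]big_ord_recl /= !bin0 -!addrA; congr (_ + _).
(* Pascal's rule; the last term of one half vanishes because ['C(n, n.+1)] is zero. *)
under eq_bigr => k _.
  rewrite binS natrD mulrDr mulrDl; over.
rewrite big_split/= big_ord_recr/= bin_small// mulr0 mul0r addr0; congr (_ + _).
by rewrite -sumrN; apply: eq_bigr => k _; rewrite exprS !mulN1r !mulNr.
Qed.

Lemma cosB_cos (R : realType) (a b : R) :
  cos a - cos b = 2 * sin ((b - a) / 2) * sin ((a + b) / 2).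
Proof.
have sumprod u v : cos (u - v) - cos (u + v) = 2 * sin v * sin u :> R.
  by rewrite cosB cosD; ring.
have := sumprod ((a + b) / 2) ((b - a) / 2).
have -> : (a + b) / 2 - (b - a) / 2 = a by field.
by have -> : (a + b) / 2 + (b - a) / 2 = b by field.
Qed.

(* Both sides are the real part of [exp(ia) * (1 - exp(i phi))^n]. *)
Lemma sum_sign_bin_cos (R : realType) (n : nat) (a phi : R) :
  \sum_(k < n.+1) (-1) ^+ k * 'C(n, k)%:R * cos (a + k%:R * phi) =
  (2 * sin (phi / 2)) ^+ n * cos (a + n%:R * ((phi - pi) / 2)).
Proof.
elim: n a => [|n IHn] a.
  by rewrite big_ord1 bin0 expr0 !mul1r !mul0r.
rewrite (sum_sign_binS _ n (fun k => cos (a + k%:R * phi))).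
under eq_bigr do rewrite mulrBr.
rewrite sumrB IHn.
under eq_bigr => k _.
  rewrite (_ : a + k.+1%:R * phi = (a + phi) + k%:R * phi); last first.
    by rewrite -(natr1 k); ring.
  over.
rewrite IHn -mulrBr cosB_cos exprSr -!mulrA; congr (_ * (_ * (sin _ * _))).
  by field.
rewrite -cosBpihalf; congr cos.
by rewrite -(natr1 n); field.
Qed.

(** Telescoping: [2 * sin (phi / 2) * cos b] is [sin (b + phi / 2) - sin (b - phi / 2)]. The factor
    is kept on the left since it may vanish. *)
Lemma sum_cos_arith (R : realType) (n : nat) (a phi : R) :
  2 * sin (phi / 2) * \sum_(i < n) cos (a + i%:R * phi) =
  sin (a + n%:R * phi - phi / 2) - sin (a - phi / 2).
Proof.
elim: n => [|n IHn]; first by rewrite big_ord0 mulr0 mul0r addr0 subrr.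
rewrite big_ord_recr/= mulrDr IHn -(natr1 n).
have -> : a + (n%:R + 1) * phi - phi / 2 = a + n%:R * phi + phi / 2 by field.
set b := a + n%:R * phi; rewrite (sinB b) (sinD b); ring.
Qed.

Lemma sinD_nat2pi (R : realType) (n : nat) (a : R) :
  sin (a + n%:R * (2 * pi)) = sin a.
Proof.
by rewrite [2 * pi]mulr_natl mulr_natl (periodicn (@sinD2pi R)).
Qed.

Lemma cosD_nat2pi (R : realType) (n : nat) (a : R) :
  cos (a + n%:R * (2 * pi)) = cos a.
Proof.
by rewrite [2 * pi]mulr_natl mulr_natl (periodicn (@cosD2pi R)).
Qed.

Lemma cos_nat_pi (R : realType) (n : nat) : cos (n%:R * pi) = (-1) ^+ n :> R.
Proof.
elim: n => [|n IHn]; first by rewrite mul0r cos0.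
by rewrite -(natr1 n) mulrDl mul1r cosDpi IHn exprS mulN1r.
Qed.

(** * Even power sums of sines at equally spaced angles *)

Section angles.
Variables (R : realType) (d : nat) (t : R).
Hypothesis d0 : (0 < d)%N.

Definition angle (i : nat) : R := pi * ((t + i%:R) / d%:R).

Let dR0 : d%:R != 0 :> R. Proof. by rewrite pnatr_eq0 -lt0n. Qed.

(** The terms form a progression of step [2 pi n / d], which makes [n] full turns in [d] steps, so
    the telescoped ends agree. The factor [sin (pi n / d)] is nonzero because [0 < n < d]. *)
Lemma sum_cos_angle_eq0 (n : nat) : (0 < n < d)%N ->
  \sum_(i < d) cos (n%:R * (2 * angle i)) = 0.
Proof.
move=> /andP[n0 nd]; pose phi : R := n%:R * (2 * pi) / d%:R.
pose a : R := n%:R * (2 * pi) * t / d%:R.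
under eq_bigr => i _.
  rewrite (_ : _ * _ = a + i%:R * phi); last first.
    by rewrite /angle /a /phi; field; rewrite dR0.
  over.
have s0 : 0 < sin (phi / 2).
  apply: sin_gt0_pi.
  have -> : phi / 2 = pi * (n%:R / d%:R) by rewrite /phi; field; rewrite dR0.
  rewrite mulr_gt0 ?pi_gt0 ?divr_gt0 ?ltr0n//=.
  by rewrite gtr_pMr ?pi_gt0// ltr_pdivrMr ?ltr0n// mul1r ltr_nat.
have /eqP := sum_cos_arith _ d a phi.
have -> : a + d%:R * phi - phi / 2 = a - phi / 2 + n%:R * (2 * pi).
  by rewrite /phi; field; rewrite dR0.
by rewrite sinD_nat2pi subrr !mulf_eq0 pnatr_eq0/= (gt_eqF s0)/= => /eqP.
Qed.

Lemma sum_cos_angle_d : \sum_(i < d) cos (d%:R * (2 * angle i)) =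
  d%:R * cos (2 * pi * t).
Proof.
under eq_bigr => i _.
  rewrite (_ : _ * _ = 2 * pi * t + i%:R * (2 * pi)); last first.
    by rewrite /angle; field; rewrite dR0.
  rewrite cosD_nat2pi; over.
by rewrite sumr_const card_ord -[LHS]mulr_natl.
Qed.

(** This is [sum_sign_bin_cos] with [a = - 2 m x] and [phi = 2 x]. With truncated subtraction,
    [(k - m) + (m - k)] is the distance of [k] and [m]: cosine is even, so frequencies can be taken
    in [nat]. *)
Lemma sin_even_expr (m : nat) (x : R) : sin x ^+ (2 * m) =
  (-1) ^+ m / 4 ^+ m *
  \sum_(k < (2 * m).+1) (-1) ^+ k * 'C(2 * m, k)%:R *
    cos (((k - m) + (m - k))%N%:R * (2 * x)).
Proof.
under eq_bigr => k _.
  rewrite (_ : cos _ = cos (- m%:R * (2 * x) + k%:R * (2 * x))); last first.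
    case: (leqP k m) => km.
      rewrite (eqP km) add0n natrB// -cosN; congr cos; ring.
    by rewrite (eqP (ltnW km)) addn0 natrB ?(ltnW km)//; congr cos; ring.
  over.
rewrite sum_sign_bin_cos.
have -> : 2 * x / 2 = x by field.
have -> : - m%:R * (2 * x) + (2 * m)%:R * ((2 * x - pi) / 2) = - (m%:R * pi).
  by rewrite natrM; field.
rewrite cosN cos_nat_pi exprMn.
have -> : 4 ^+ m = 2 ^+ (2 * m) :> R by rewrite exprM; congr (_ ^+ m); ring.
have sign2 : (-1) ^+ m * (-1) ^+ m = 1 :> R by rewrite -expr2 sqrr_sign.
by rewrite -[LHS]mul1r -[X in X * _ = _]sign2; field; rewrite expf_neq0// pnatr_eq0.
Qed.

Lemma sum_sin_evenE (m : nat) : \sum_(i < d) sin (angle i) ^+ (2 * m) =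
  (-1) ^+ m / 4 ^+ m *
  \sum_(k < (2 * m).+1) (-1) ^+ k * 'C(2 * m, k)%:R *
    \sum_(i < d) cos (((k - m) + (m - k))%N%:R * (2 * angle i)).
Proof.
under eq_bigr do rewrite sin_even_expr.
rewrite -mulr_sumr exchange_big/=; congr (_ * _).
by apply: eq_bigr => k _; rewrite mulr_sumr.
Qed.

Lemma sum_cos_angle0 : \sum_(i < d) cos (0%:R * (2 * angle i)) = d%:R.
Proof.
under eq_bigr do rewrite mul0r cos0.
by rewrite sumr_const card_ord.
Qed.

(** All frequencies are at most [m < d], so only the frequency zero, at [k = m], survives the
    summation. *)
Lemma sum_sin_even_lt (m : nat) : (m < d)%N ->
  \sum_(i < d) sin (angle i) ^+ (2 * m) = d%:R / 4 ^+ m * 'C(2 * m, m)%:R.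
Proof.
move=> md; rewrite sum_sin_evenE.
have mm : (m < (2 * m).+1)%N by lia.
rewrite (bigD1 (Ordinal mm))//= subnn addn0 sum_cos_angle0 big1 ?addr0.
  have sign2 : (-1) ^+ m * (-1) ^+ m = 1 :> R.
    by rewrite -expr2 sqrr_sign.
  by rewrite -[RHS]mul1r -[X in _ = X * _]sign2; field; rewrite expf_neq0// pnatr_eq0.
move=> k; rewrite -val_eqE/= => km; rewrite sum_cos_angle_eq0 ?mulr0//.
by have := ltn_ord k; lia.
Qed.

Lemma sum_sin_even_d : \sum_(i < d) sin (angle i) ^+ (2 * d) =
  d%:R / 4 ^+ d * ('C(2 * d, d)%:R + (-1) ^+ d * 2 * cos (2 * pi * t)).
Proof.
rewrite sum_sin_evenE.
have dd : (d < (2 * d).+1)%N by lia.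
rewrite (bigD1 (Ordinal dd))//= subnn addn0 sum_cos_angle0.
have d0_neq : ord0 != Ordinal dd by rewrite -val_eqE/= neq_ltn d0.
have d2_neq : (ord_max != Ordinal dd) && (ord_max != ord0 :> 'I_(2 * d).+1).
  by rewrite -!val_eqE/=; lia.
(* Besides [k = d], the two end terms survive: both have frequency exactly [d]. *)
rewrite (bigD1 ord0)//= (bigD1 ord_max)//=.
rewrite sub0n add0n subn0 bin0 expr0.
have -> : (2 * d - d + (d - 2 * d) = d)%N by lia.
rewrite binn sum_cos_angle_d big1 ?addr0.
  have sign2 : (-1) ^+ d * (-1) ^+ d = 1 :> R.
    by rewrite -expr2 sqrr_sign.
  have -> : (-1) ^+ (2 * d) = 1 :> R by rewrite exprM sqrrN expr1n expr1n.
  rewrite -['C(_, _)%:R in RHS]mul1r -[X in _ = _ * (X * _ + _)]sign2.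
  by field; rewrite expf_neq0// pnatr_eq0.
move=> k; rewrite -!val_eqE/= => km; rewrite sum_cos_angle_eq0 ?mulr0//.
by have := ltn_ord k; lia.
Qed.

End angles.

(** * Iterated Rolle, interpolation and divided differences of powers *)

Lemma rolle_path (R : realType) (f f' : R -> R) (a : R) (s : seq R) :
    (forall x : R, 0 < x -> is_derive x 1 f (f' x)) ->
    0 < a -> path <%R a s -> f a = 0 -> (forall x, x \in s -> f x = 0) ->
  exists u : seq R, [/\ path <%R a u, size u = size s &
    forall x, x \in u -> f' x = 0].
Proof.
move=> df; elim: s a => [|b s IHs] a a0 /=; first by exists [::].
move=> /andP[ab bs] fa fs.
have b0 : 0 < b by exact: lt_trans ab.
have fb : f b = 0 by apply: fs; rewrite mem_head.
have [|u [bu su f'u]] := IHs b b0 bs fb.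
  by move=> x xs; apply: fs; rewrite inE xs orbT.
have fab x : a <= x -> derivable f x 1.
  by move=> ax; have [] := df x (lt_le_trans a0 ax).
have dab x : x \in `]a, b[ -> derivable f x 1.
  by rewrite in_itv/= => /andP[ax _]; exact/fab/ltW.
have cab : {within `[a, b], continuous f}%classic.
  apply: derivable_within_continuous => x.
  by rewrite in_itv/= => /andP[ax _]; exact: fab.
have [|c] := Rolle ab dab cab; first by rewrite fa fb.
rewrite in_itv/= => /andP[ac cb] fc0.
exists (c :: u); split => /=; last 1 first.
- move=> x; rewrite inE => /predU1P[->|]; last exact: f'u.
  have [_ <-] := df c (lt_trans a0 ac).
  by have [_ ->] := fc0.
(* [c < b], and [b] lies below all of [u], so the path can start from [c]. *)
- rewrite ac/=; case: u bu {su f'u} => //= e u /andP[be ->].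
  by rewrite (lt_trans cb be).
- by rewrite su.
Qed.

(** Each differentiation costs one zero. Derivatives are only asked for at positive points, where
    real powers are differentiable. *)
Lemma iterated_rolle (R : realType) (F : nat -> R -> R) (n : nat) (s : seq R) :
    (forall k (x : R), 0 < x -> is_derive x 1 (F k) (F k.+1 x)) ->
    path <%R 0 s -> size s = n.+1 -> (forall x : R, x \in s -> F 0%N x = 0) ->
  exists2 xi, 0 < xi & F n xi = 0.
Proof.
elim: n F s => [|n IHn] F [//|a s] dF /= /andP[a0 as_] [sn] F0.
  by exists a => //; apply: F0; rewrite mem_head.
have [||u [au su Fu]] := rolle_path R (F 0%N) (F 1%N) a s (dF 0%N) a0 as_.
- by apply: F0; rewrite mem_head.
- by move=> x xs; apply: F0; rewrite inE xs orbT.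
apply: (IHn (fun k => F k.+1) u _ _ _ Fu); last by rewrite su.
case: u au {su Fu} => //= b u /andP[ab ->].
  by rewrite (lt_trans a0 ab).
Qed.

(** The coefficients solve a linear system whose Vandermonde matrix is invertible for distinct
    nodes. *)
Lemma interpolation (F : fieldType) (n : nat) (x y : 'I_n -> F) :
    injective x ->
  exists2 p : {poly F}, (size p <= n)%N & forall i, p.[x i] = y i.
Proof.
move=> xinj; pose V := Vandermonde n (\row_i x i).
have Vu : V \in unitmx.
  rewrite unitmxE det_Vandermonde unitfE.
  apply/prodf_neq0 => i _; apply/prodf_neq0 => j ij.
  rewrite !mxE subr_eq0 (inj_eq xinj).
  by apply: contraTneq ij => ->; rewrite ltnn.
have sp : (size (rVpoly ((\row_i y i) *m invmx V)) <= n)%N by exact: size_poly.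
exists (rVpoly ((\row_i y i) *m invmx V)) => // i.
rewrite (horner_coef_wide _ sp).
transitivity (((\row_i y i) *m invmx V *m V) 0 i); last by rewrite mulmxKV ?mxE.
rewrite [RHS]mxE; apply: eq_bigr => j _.
by rewrite coef_rVpoly_ord; congr (_ * _); rewrite !mxE.
Qed.

(** Let [p] interpolate the power at the nodes. The weights annihilate monomials of degree below
    [n], so the weighted sum sees only the leading coefficient [p_n]; Rolle applied to the power
    minus [p] evaluates [p_n] at some [xi]. *)
Lemma divided_difference_powR (R : realType) (n : nat) (x w : 'I_n.+1 -> R)
    (r : R) :
    injective x -> (forall i, 0 < x i) ->
    (forall j, (j < n)%N -> \sum_i w i * x i ^+ j = 0) ->
  exists2 xi, 0 < xi &
    n`!%:R * (\sum_i w i * x i `^ r) =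
    (\prod_(j < n) (r - j%:R)) * xi `^ (r - n%:R) * \sum_i w i * x i ^+ n.
Proof.
move=> xinj x0 w0.
have [p sp pE] := interpolation R n.+1 x (fun i => x i `^ r) xinj.
pose F k y := (\prod_(j < k) (r - j%:R)) * y `^ (r - k%:R) - p^`(k).[y].
have dF k (y : R) : 0 < y -> is_derive y 1 (F k) (F k.+1 y).
  move=> y0; rewrite /F.
  have := is_derive1_powR (r - k%:R) y0 => dp.
  have dh := is_derive_poly p^`(k) y.
  have dcp := is_deriveZ (\prod_(j < k) (r - j%:R)) dp.
  apply: (is_derive_eq (is_deriveB dcp dh)).
  rewrite derivnS big_ord_recr/= -mulrA.
  by rewrite [_ *: _]/(_ * _) -addn1 natrD opprD addrA.
pose s := sort <=%R (codom x).
have s_path : path <%R 0 s.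
  rewrite path_min_sorted.
    by rewrite sort_lt_sorted; apply/injectiveP.
  by apply/allP => y; rewrite mem_sort => /codomP[i ->].
have [||xi xi0 Fxi] := iterated_rolle R F n s dF s_path.
- by rewrite size_sort size_codom card_ord.
- move=> y; rewrite mem_sort => /codomP[i ->].
  by rewrite /F big_ord0 mul1r subr0 pE subrr.
exists xi => //.
have -> : \sum_i w i * x i `^ r = p`_n * \sum_i w i * x i ^+ n.
  under eq_bigr => i _.
    rewrite -pE (horner_coef_wide _ sp) mulr_sumr; over.
  rewrite exchange_big/= big_ord_recr/= big1 ?add0r; last first.
    move=> j _; rewrite -[RHS](mulr0 p`_j) -[X in _ = _ * X](w0 j (ltn_ord j)) mulr_sumr.
    by apply: eq_bigr => i _; rewrite mulrCA.
  by rewrite mulr_sumr; apply: eq_bigr => i _; rewrite mulrCA.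
rewrite mulrA; congr (_ * _); apply/eqP; rewrite eq_sym -subr_eq0; apply/eqP.
rewrite -[RHS]Fxi /F; congr (_ - _).
(* The degree of [p] is at most [n], so its [n]-th derivative is constant. *)
have -> : p^`(n) = (n`!%:R * p`_n)%:P; last by rewrite hornerC.
apply/polyP => i; rewrite coef_derivn coefC; case: i => [|i] /=.
  by rewrite addn0 ffactnn mulr_natl.
by rewrite nth_default ?mul0rn// (leq_trans sp)// -addSnnS leq_addr.
Qed.

(** The first [k] factors are positive and the following [m] are negative. *)
Lemma prod_sub_sign (R : realDomainType) (k m : nat) (r : R) :
    (forall j, (j < k)%N -> j%:R < r) ->
    (forall j, (k <= j < k + m)%N -> r < j%:R) ->
  0 < (-1) ^+ m * \prod_(j < k + m) (r - j%:R).
Proof.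
move=> jr; elim: m => [_|m IHm rj].
  rewrite addn0 mul1r; apply: prodr_gt0 => j _.
  by rewrite subr_gt0; exact: jr.
rewrite addnS big_ord_recr/= exprS mulN1r mulNr -!mulrN opprB mulrA.
rewrite mulr_gt0 ?subr_gt0 ?rj ?leq_addr ?addnS//=.
by apply: IHm => j /andP[kj jkm]; apply: rj; rewrite kj addnS ltnW.
Qed.

(** * Even exponents, and the nodes [sin^2] of the angles *)

Lemma h1_even (R : realType) (d m : nat) (t : R) :
  h1 d (2 * m)%:R t = d%:R^-1 * \sum_(i < d) sin (angle R d t i) ^+ (2 * m).
Proof.
congr (_ * _); apply: eq_bigr => i _.
by rewrite powR_mulrn// exprM real_normK ?num_real// -exprM.
Qed.

Lemma h1_even_lt (R : realType) (d m : nat) (t : R) : (m < d)%N ->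
  h1 d (2 * m)%:R t = (4 ^+ m)^-1 * 'C(2 * m, m)%:R.
Proof.
move=> md; have d0 : (0 < d)%N by exact: leq_ltn_trans md.
rewrite h1_even sum_sin_even_lt// !mulrA mulVf ?mul1r//.
by rewrite pnatr_eq0 -lt0n.
Qed.

Lemma h1_even_d (R : realType) (d : nat) (t : R) : (0 < d)%N ->
  h1 d (2 * d)%:R t =
  (4 ^+ d)^-1 * ('C(2 * d, d)%:R + (-1) ^+ d * 2 * cos (2 * pi * t)).
Proof.
move=> d0; rewrite h1_even sum_sin_even_d// !mulrA mulVf ?mul1r//.
by rewrite pnatr_eq0 -lt0n.
Qed.

Lemma sin_angle_gt0 (R : realType) (d i : nat) (t : R) :
  0 < t < 1 -> (i < d)%N -> 0 < sin (angle R d t i).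
Proof.
move=> /andP[t0 t1] id; apply: sin_gt0_pi.
have d0 : 0 < d%:R :> R by rewrite ltr0n (leq_ltn_trans _ id).
have i0 : 0 <= i%:R :> R by rewrite ler0n.
have id1 : i%:R + 1 <= d%:R :> R by rewrite natr1 ler_nat.
rewrite /angle mulr_gt0 ?pi_gt0 ?divr_gt0//=; last lra.
by rewrite gtr_pMr ?pi_gt0// ltr_pdivrMr// mul1r; lra.
Qed.

Lemma sin2B (R : realType) (a b : R) :
  sin a ^+ 2 - sin b ^+ 2 = sin (a + b) * sin (a - b).
Proof.
rewrite sinD sinB.
transitivity (sin a ^+ 2 * cos b ^+ 2 - cos a ^+ 2 * sin b ^+ 2); last by ring.
by rewrite !cos2sin2; ring.
Qed.

(** By [sin2B], a collision would make the sum or the difference of two angles a multiple of [pi].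
    The difference is [pi (j - i) / d], strictly between [0] and [pi]; the sum is
    [pi (2 t + i + j) / d], where [2 t] is not an integer. *)
Lemma sin2_angle_inj (R : realType) (d : nat) (t : R) : 0 < t < 1 / 2 ->
  injective (fun i : 'I_d => sin (angle R d t i) ^+ 2).
Proof.
move=> /andP[t0 t1].
suff lt_neq (i j : 'I_d) : (i < j)%N ->
    sin (angle R d t j) ^+ 2 != sin (angle R d t i) ^+ 2.
  move=> i j /eqP sij; apply/val_inj; apply/eqP.
  case: (ltngtP i j) => // /lt_neq; by rewrite ?sij // eq_sym sij.
move=> ij; have dn0 : (0 < d)%N by exact: leq_ltn_trans (ltn_ord i).
have d0 : 0 < d%:R :> R by rewrite ltr0n.
have dR0 : d%:R != 0 :> R by rewrite gt_eqF.
have sin_frac (x : R) : 0 < x < d%:R -> 0 < sin (pi * (x / d%:R)).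
  move=> /andP[x0 xd]; apply: sin_gt0_pi.
  rewrite mulr_gt0 ?pi_gt0 ?divr_gt0//=.
  by rewrite gtr_pMr ?pi_gt0// ltr_pdivrMr// mul1r.
have i0 : 0 <= i%:R :> R by rewrite ler0n.
have j0 : 0 <= j%:R :> R by rewrite ler0n.
have jd : j%:R + 1 <= d%:R :> R by rewrite natr1 ler_nat.
have ijR : i%:R + 1 <= j%:R :> R by rewrite natr1 ler_nat.
rewrite -subr_eq0 sin2B mulf_neq0//; last first.
  have -> : angle R d t j - angle R d t i = pi * ((j%:R - i%:R) / d%:R).
    by rewrite /angle; field.
  by rewrite gt_eqF// sin_frac//; lra.
(* If [i + j >= d] the sum of the angles exceeds [pi], and one half-turn is removed first. *)
have [dij|ijd] := leqP d (j + i).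
  have dijR : d%:R <= j%:R + i%:R :> R by rewrite -natrD ler_nat.
  have -> : angle R d t j + angle R d t i =
      pi * ((2 * t + j%:R + i%:R - d%:R) / d%:R) + pi.
    by rewrite /angle; field.
  by rewrite sinDpi oppr_eq0 gt_eqF// sin_frac//; lra.
have ijdR : j%:R + i%:R + 1 <= d%:R :> R by rewrite -natrD natr1 ler_nat.
have -> : angle R d t j + angle R d t i = pi * ((2 * t + j%:R + i%:R) / d%:R).
  by rewrite /angle; field.
by rewrite gt_eqF// sin_frac//; lra.
Qed.

(** * The derivative of [h1] as a moment, and the sign of the moments *)

Definition moment (R : realType) (d : nat) (t r : R) : R :=
  \sum_(i < d) sin (angle R d t i) * cos (angle R d t i) *
      (sin (angle R d t i) ^+ 2) `^ r.

Lemma is_derive_h1 (R : realType) (d : nat) (q t : R) : 0 < t < 1 ->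
  is_derive t 1 (h1 d q)
    (pi * q / d%:R ^+ 2 * moment R d t (q / 2 - 1)).
Proof.
move=> t01.
have dterm (i : 'I_d) :
    is_derive t 1 (fun u : R => `|sin (angle R d u i)| `^ q)
    (q * sin (angle R d t i) `^ (q - 1) *
      (cos (angle R d t i) * (pi / d%:R))).
  apply: (@near_eq_is_derive _ _ _
      ((@powR R)^~ q \o (@sin R \o (fun u => angle R d u i)))).
    have /near_in_itvoo : t \in `]0, 1[ by rewrite in_itv/=.
    apply: filterS => u; rewrite in_itv/= => u01.
    by rewrite ger0_norm// ltW// sin_angle_gt0.
  have dangle : is_derive t 1 (fun u => angle R d u i) (pi / d%:R).
    have -> : (fun u => angle R d u i) = (pi / d%:R) \*: (id + cst i%:R).
      by apply/funext => u; rewrite /angle mulrA mulrAC.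
    apply: is_derive_eq.
    by rewrite addr0 [_ *: _]mulr1.
  have := is_derive1_powR q (sin_angle_gt0 R d i t t01 (ltn_ord i)) => dpow.
  exact: is_derive1_comp.
have -> : h1 d q = d%:R^-1 \*:
    \sum_(i < d) (fun u : R => `|sin (angle R d u i)| `^ q).
  by apply/funext => u; rewrite /= fct_sumE.
apply: is_derive_eq.
transitivity (d%:R^-1 * \sum_(i < d) q * sin (angle R d t i) `^ (q - 1) *
    (cos (angle R d t i) * (pi / d%:R))); first by [].
rewrite /moment !mulr_sumr; apply: eq_bigr => i _.
have s0 := sin_angle_gt0 R d i t t01 (ltn_ord i).
rewrite -powR_mulrn ?ltW// -powRrM.
have -> : sin (angle R d t i) `^ (q - 1) =
    sin (angle R d t i) * sin (angle R d t i) `^ (2 * (q / 2 - 1)).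
  rewrite -{2}[sin _]powRr1 ?ltW// -powRD; last by rewrite (gt_eqF s0) /= implybT.
  by congr (_ `^ _); field.
by field; rewrite pnatr_eq0 -lt0n (leq_ltn_trans _ (ltn_ord i)).
Qed.

(** The exponent [j] corresponds to [q = 2 (j + 1) < 2 d], for which [h1] is constant. *)
Lemma moment_nat_eq0 (R : realType) (d j : nat) (t : R) : 0 < t < 1 ->
  (j.+1 < d)%N -> moment R d t j%:R = 0.
Proof.
move=> t01 jd.
have := is_derive_h1 R d (2 * j.+1)%:R t t01.
have -> : (2 * j.+1)%:R / 2 - 1 = j%:R :> R by rewrite natrM -natr1; field.
have -> : h1 d (2 * j.+1)%:R = cst ((4 ^+ j.+1)^-1 * 'C(2 * j.+1, j.+1)%:R) :> (R -> R).
  by apply/funext => u; rewrite h1_even_lt.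
move=> /@derive_val; rewrite derive_cst => /esym/eqP.
rewrite !mulf_eq0 invr_eq0 expf_eq0/= !pnatr_eq0 (gt_eqF (pi_gt0 R)) /=.
by case: d jd => //= d _ /eqP.
Qed.

(** The exponent [n] corresponds to [q = 2 d] with [d = n.+1]. There [h1'] is a positive multiple of
    [(-1)^n sin (2 pi t)], and this sine is positive for [0 < t < 1 / 2]. *)
Lemma moment_nat_sign (R : realType) (n : nat) (t : R) : 0 < t < 1 / 2 ->
  0 < (-1) ^+ n * moment R n.+1 t n%:R.
Proof.
move=> /andP[t0 t12]; have t01 : 0 < t < 1 by lra.
have s0 : 0 < sin (2 * pi * t).
  apply: sin_gt0_pi; have := pi_gt0 R => pi0; apply/andP; split; nra.
have := is_derive_h1 R n.+1 (2 * n.+1)%:R t t01.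
have -> : (2 * n.+1)%:R / 2 - 1 = n%:R :> R by rewrite natrM -natr1; field.
have -> : h1 n.+1 (2 * n.+1)%:R =
    (4 ^+ n.+1)^-1 \*: (cst 'C(2 * n.+1, n.+1)%:R +
      ((-1) ^+ n.+1 * 2) \*: (@cos R \o ((2 * pi) \*: id))) :> (R -> R).
  by apply/funext => u; rewrite h1_even_d.
move=> /@derive_val; rewrite derive_val add0r.
set M := moment R n.+1 t n%:R => E.
have {}E : 4 ^- n.+1 * ((-1) ^+ n.+1 * 2 * (- sin (2 * pi * t) * (2 * pi * 1))) =
    pi * (2 * n.+1)%:R / n.+1%:R ^+ 2 * M by exact: E.
have D0 : n.+1%:R != 0 :> R by rewrite pnatr_eq0.
have pi0 : pi != 0 :> R by rewrite gt_eqF// pi_gt0.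
have -> : M = (-1) ^+ n * (2 * n.+1%:R * sin (2 * pi * t) / 4 ^+ n.+1).
  have /mulfI : pi * (2 * n.+1)%:R / n.+1%:R ^+ 2 != 0 :> R.
    by rewrite !mulf_neq0// invr_eq0 expf_neq0.
  apply; rewrite -E (exprS (-1)) mulN1r natrM; field.
  by rewrite nat1r D0 expf_neq0// pnatr_eq0.
rewrite mulrA -expr2 sqrr_sign mul1r.
by rewrite divr_gt0 ?exprn_gt0 ?mulr_gt0.
Qed.

(** Of the factors [r - j] with [j < n], the first [k] are positive and [n - k] are negative. The
    signs [(-1)^(n - k)] of the product and [(-1)^n] of the moment of order [n] combine to [(-1)^k].
    The implication leaves [r] unbounded above when [k = n]. *)
Lemma moment_sign (R : realType) (n k : nat) (t r : R) : 0 < t < 1 / 2 ->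
    (k <= n)%N -> k%:R - 1 < r -> (k < n)%N ==> (r < k%:R) ->
  0 < (-1) ^+ k * moment R n.+1 t r.
Proof.
move=> t012 kn kr rk; have t01 : 0 < t < 1 by lra.
pose s i := sin (angle R n.+1 t i).
have s0 (i : 'I_n.+1) : 0 < s i by exact: sin_angle_gt0.
have x0 (i : 'I_n.+1) : 0 < s i ^+ 2 by rewrite exprn_gt0.
have momentE (j : nat) : moment R n.+1 t j%:R =
    \sum_(i < n.+1) s i * cos (angle R n.+1 t i) * (s i ^+ 2) ^+ j.
  by apply: eq_bigr => i _; rewrite powR_mulrn ?sqr_ge0.
have mom0 j : (j < n)%N ->
    \sum_(i < n.+1) s i * cos (angle R n.+1 t i) * (s i ^+ 2) ^+ j = 0.
  by move=> jn; rewrite -momentE moment_nat_eq0.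
have [xi xi0] := divided_difference_powR R n _ _ r
  (sin2_angle_inj R n.+1 t t012) x0 mom0.
rewrite -momentE -/(moment R n.+1 t r) => mr.
have fact0 : 0 < n`!%:R :> R by rewrite ltr0n fact_gt0.
rewrite -(pmulr_rgt0 _ fact0) mulrCA mr.
have prod0 : 0 < (-1) ^+ (n - k) * \prod_(j < n) (r - j%:R).
  have := prod_sub_sign R k (n - k) r; rewrite subnKC//; apply=> j.
    by rewrite -(ler_nat R) -natr1 => jk; lra.
  move=> /andP[kj jn]; move: rk; rewrite (leq_ltn_trans kj jn)/= => rk.
  by rewrite (lt_le_trans rk)// ler_nat.
have -> : (-1) ^+ k = (-1) ^+ (n - k) * (-1) ^+ n :> R.
  by rewrite -signr_odd -exprD -[RHS]signr_odd oddD oddB// -addbA addbCA addbb addbF.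
rewrite mulrACA mulr_gt0 ?moment_nat_sign//.
by rewrite mulrA mulr_gt0 ?powR_gt0.
Qed.


Theorem lemma3p2 (R : realType) (d : nat) (q : R) (hd : (2 <= d)%N)
    (hq : 0 < q) :
  (forall j : nat, (1 <= j <= d - 1)%N -> q = (2 * j)%:R ->
     forall t : R, 0 <= t <= 1 ->
       h1 d q t = 1 / 2 `^ q * 'C(2 * j, j)%:R)
  /\
  (forall k : nat, (1 <= k <= d)%N -> q \in Q R d k ->
     forall t : R, 0 < t < 1 / 2 ->
       derivable (h1 d q) t 1 /\
       0 < (-1) ^+ (k - 1) * derive1 (h1 d q) t).
Proof.
split=> [j jd -> t _|].
  rewrite h1_even_lt; last by lia.
  rewrite powR_mulrn// exprM mul1r; congr (_^-1 * _); congr (_ ^+ j); ring.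
case: d hd => // n _ [//|k] kn; rewrite /Q subn1/= => qk t t012.
have t01 : 0 < t < 1 by lra.
have dh := is_derive_h1 R n.+1 q t t01.
split; first by case: dh.
(* The positive factor [pi q / d^2] is split off, leaving the signed moment. *)
rewrite derive1E derive_val mulrCA.
apply: mulr_gt0; first by rewrite divr_gt0 ?mulr_gt0 ?pi_gt0 ?exprn_gt0.
(* Here [k] and [d] have been lowered by one, so [Q] reads [2 k < q < 2 (k + 1)], without the upper
   bound when [k = n]. *)
have [kq qk'] : k%:R - 1 < q / 2 - 1 /\ ((k < n)%N -> q / 2 - 1 < k%:R).
  move: qk; rewrite ltnS -(natr1 k) -(natr1 n); case: ltnP => kn'; rewrite in_itv/=.
    by move=> /andP[? ?]; split=> [|_]; lra.
  rewrite andbT => nq; split=> //.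
  have : k%:R <= n%:R :> R by rewrite ler_nat.
  lra.
by apply: moment_sign => //; apply/implyP.
Qed.
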